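(* Let $\mathbb{A}$ be a finite alphabet, let $(\mu_\omega)_{\omega\in\Omega}$ be a finite nonempty family of finite, nonzero empirical measures on $\mathbb{A}$, and let $P=(p_\omega)_{\omega\in\Omega}$ be a probability measure on $\Omega$. Then \[ \min_{\ell}\max_{\omega\in\Omega}\sum_{a\in\mathbb{A}}\ell(a)\,\mu_\omega(a) =\min_{\ell}\sum_{\omega\in\Omega}p_\omega\left(\sum_{a\in\mathbb{A}}\ell(a)\,\mu_\omega(a)\right) \] if and only if $\sum_{\omega\in\Omega}p_\omega\,\mu_\omega=\mu^*$, where $\mu^*$ is the maximum entropy measure in the convex hull of $\{\mu_\omega:\omega\in\Omega\}$. Here both minima are over all functions $\ell:\mathbb{A}\to[0,\infty]$ satisfying Kraft's Inequality $\sum_{a\in\mathbb{A}}\exp(-\ell(a))\le 1$.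
   Context: An empirical measure is a measure $\mu$ such that $\mu(A)$ is a (nonnegative) integer or $\infty$ for every measurable set $A$; here all empirical measures come from finite texts (letter counts), so they take finite integer values. For a measure $\mu$ on $\mathbb{A}$, $\|\mu\|=\mu(\mathbb{A})$. The entropy of a finite nonzero measure $\mu$ is $H(\mu)=\|\mu\|\cdot H(\mu/\|\mu\|)$, where for a probability measure $Q$ on $\mathbb{A}$, $H(Q)=-\sum_{a}Q(a)\ln Q(a)$ (with $0\ln 0=0$). The maximum entropy measure in a convex set $C$ of measures is the element $\mu^*\in C$ with $H(\mu^* )=\max_{\mu\in C}H(\mu)$. Conventions: $\exp(-\infty)=0$, $\infty\cdot 0=0$. *)

(* Defs.v *)
From HB Require Import structures.
From mathcomp Require Import all_boot all_order all_algebra.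
From mathcomp Require Import all_classical all_reals all_analysis.

Set Implicit Arguments.
Unset Strict Implicit.
Unset Printing Implicit Defensive.

Import Order.TTheory GRing.Theory Num.Theory.

Local Open Scope classical_set_scope.
Local Open Scope ring_scope.
Local Open Scope ereal_scope.

(* Measurable types are pointed, so the alphabet is nonempty; this is no
   restriction when it carries a nonzero measure. *)
#[short(type="finMeasurableType")]
HB.structure Definition FinMeasurable d := {T of Finite T & Measurable d T}.

(* The value +oo is allowed here; finiteness is imposed separately. *)
Definition empirical (R : realType) (d : measure_display)
    (A : measurableType d) (nu : set A -> \bar R) : Prop :=
  forall X : set A, measurable X -> nu X = +oo \/ exists n : nat, nu X = n%:R%:E.

Definition prob_weights (R : realType) (I : finType) (q : I -> R) : Prop :=
  (forall i, (0 <= q i)%R) /\ (\sum_i q i = 1)%R.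

Definition mixture (R : realType) (A : Type) (I : finType)
    (q : I -> R) (m : I -> set A -> \bar R) : set A -> \bar R :=
  fun X => \sum_i (q i)%:E * m i X.

(* The measures on the discrete sigma-algebra of A are handled as set functions
   defined on all subsets of A. *)
Definition convex_hull (R : realType) (A : Type)
    (S : set (set A -> \bar R)) : set (set A -> \bar R) :=
  [set nu | exists (n : nat) (q : 'I_n -> R) (m : 'I_n -> set A -> \bar R),
      [/\ prob_weights q, forall i, S (m i) & nu = mixture q m]].

(* The convention 0 ln 0 = 0 holds since the library's [ln] is total. *)
Definition prob_entropy (R : realType) (A : finType)
    (Q : set A -> \bar R) : R :=
  (- \sum_(a : A) fine (Q [set a]) * ln (fine (Q [set a])))%R.

Definition normalized (R : realType) (A : Type)
    (nu : set A -> \bar R) : set A -> \bar R :=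
  fun X => nu X * ((fine (nu setT))^-1)%:E.

(* Only meaningful for finite nonzero measures. *)
Definition entropy (R : realType) (A : finType) (nu : set A -> \bar R) : R :=
  (fine (nu setT) * prob_entropy (normalized nu))%R.

(* On a convex [C] a maximizer is unique, unless all measures in [C] charge only one
   common letter: the entropy is then identically 0 on [C]. *)
Definition max_entropy_measure (R : realType) (A : finType)
    (C : set (set A -> \bar R)) (nu : set A -> \bar R) : Prop :=
  C nu /\ forall nu', C nu' -> (entropy nu' <= entropy nu)%R.

(* The code lengths l : A -> [0, +oo] satisfying Kraft's inequality;
   [expeR -oo = 0]. *)
Definition kraft (R : realType) (A : finType) : set (A -> \bar R) :=
  [set l | (forall a, 0 <= l a) /\ \sum_(a : A) expeR (- l a) <= 1].
Arguments kraft R A : clear implicits.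

(* In [\bar R], +oo * 0 = 0. *)
Definition code_length (R : realType) (A : finType)
    (l : A -> \bar R) (nu : set A -> \bar R) : \bar R :=
  \sum_(a : A) l a * nu [set a].

Definition is_min (R : realType) (S : set (\bar R)) (x : \bar R) : Prop :=
  S x /\ lbound S x.

(* Main.v *)
(** For a measure y of mass N, the code lengths ln (N / y a) satisfy Kraft's
inequality and attain the Gibbs bound H(y) <= code length, so the minimal
average length is the entropy of the p-mixture.  For the minimax, let y
maximize the entropy over the mixtures.  Moving y towards mu_w by a factor t and
applying Gibbs to the perturbed code gives, as t -> 0, that the optimal code of y
has length at most H(y) on every mu_w; the average of the lengths with
the weights of y is at least H(y), so the minimax value is H(y).  Both values agree
iff the p-mixture has maximal entropy. *)

From HB Require Import structures.
From mathcomp Require Import all_boot all_order all_algebra.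
From mathcomp Require Import all_classical all_reals all_analysis.
From mathcomp Require Import ring lra.
Require Import Defs.

Set Implicit Arguments.
Unset Strict Implicit.
Unset Printing Implicit Defensive.
Import Order.TTheory GRing.Theory Num.Theory.
Import numFieldNormedType.Exports.
Local Open Scope classical_set_scope.
Local Open Scope ring_scope.

(** * Continuity of [x ln x] and maxima over the simplex *)

Lemma cvg_sumr (R : realType) (T : Type) (F : set_system T) (I : finType)
    {FF : Filter F} (f : I -> T -> R) (l : I -> R) :
  (forall i, f i x @[x --> F] --> l i) ->
  \sum_i f i x @[x --> F] --> \sum_i l i.
Proof. by move=> fl; apply: cvg_big => //; exact: add_continuous. Qed.

(** With [s] the square root of [x > 0], [x ln x = 2 s (s ln s)], and [- ln s < 1 / s] bounds the
    bracket. This controls [x ln x] near 0. *)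
Lemma norm_xlnx_le (R : realType) (x : R) :
  x < 1 -> `|x * ln x| <= 2 * Num.sqrt x.
Proof.
move=> x1; have [x0|x0] := leP x 0.
  by rewrite ln0// mulr0 normr0 mulr_ge0// sqrtr_ge0.
rewrite ler0_norm; last by rewrite pmulr_rle0// ln_le0// ltW.
have s0 : 0 < Num.sqrt x by rewrite sqrtr_gt0.
have e : x = Num.sqrt x ^+ 2 by rewrite sqr_sqrtr// ltW.
have := @ln_sublinear R (Num.sqrt x)^-1.
rewrite invr_gt0 => /(_ s0); rewrite lnV ?posrE// => h.
rewrite {1 2}e lnXn// -mulr_natr.
have h2 : Num.sqrt x * (- ln (Num.sqrt x)) < 1.
  by rewrite mulrC -ltr_pdivlMr// mul1r.
set s := Num.sqrt x in s0 h2 *; nra.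
Qed.

Lemma continuous_xlnx (R : realType) : continuous (fun x : R => x * ln x).
Proof.
move=> x; have [x0|x0|->] := ltgtP x 0.
(* Left of 0 the function is constantly 0, since [ln] takes the default value 0 there. *)
- rewrite /continuous_at (ln0 (ltW x0)) mulr0.
  apply: cvg_near_cst; near=> y; rewrite ln0 ?mulr0//; near: y.
  by apply: filterS (lt_nbhsl x0) => y /ltW.
- by apply: cvgM; [exact: cvg_id|exact: continuous_ln].
- rewrite /continuous_at mul0r; apply/cvgr0Pnorm_lt => e e0.
  have e2 : 0 < e / 2 by rewrite divr_gt0.
  near=> y.
  apply: (le_lt_trans (norm_xlnx_le _)).
    by near: y; exact: lt_nbhsl.
  rewrite mulrC -ltr_pdivlMr//.
  rewrite -[ltRHS](ger0_norm (ltW e2)) -sqrtr_sqr ltr_sqrt ?exprn_gt0//.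
  near: y; apply: lt_nbhsl. by rewrite exprn_gt0.
Unshelve. all: by end_near.
Qed.

(** The simplex is compact, being closed in the cube of vectors with entries in [[0, 1]], so the
    extreme value theorem applies; [p] shows that it is nonempty. Row vectors carry the topology. *)
Lemma simplex_max (R : realType) (I : finType) (f : (I -> R) -> R) (p : I -> R) :
  prob_weights p ->
  continuous (fun v : 'rV[R]_#|I| => f (fun i => v ord0 (enum_rank i))) ->
  exists2 q : I -> R, prob_weights q & forall q', prob_weights q' -> f q' <= f q.
Proof.
move=> pP cf; pose w (v : 'rV[R]_#|I|) i := v ord0 (enum_rank i).
have cw i : continuous (w^~ i) by move=> v; exact: coord_continuous.
have wE (q : I -> R) : w (\row_j q (enum_val j)) = q.
  by apply/funext => i; rewrite /w mxE enum_rankK.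
pose S := [set v | prob_weights (w v)].
have cS : compact S.
  have -> : S = [set v : 'rV[R]_#|I| | forall i, `[0, 1]%classic (v ord0 i)] `&`
     (fun v => \sum_i w v i) @^-1` [set 1].
    apply/seteqP; split=> v /=.
      move=> [w0 w1]; split=> // j; rewrite in_itv/=.
      have := w0 (enum_val j); rewrite /w enum_valK => -> /=.
      rewrite -w1 (bigD1 (enum_val j))//= {1}/w enum_valK lerDl.
      by apply: sumr_ge0 => i _; exact: w0.
    by move=> [w0 w1]; split=> // i; have := w0 (enum_rank i);
      rewrite in_itv/= => /andP[].
  apply: compact_closedI.
    by apply: (@rV_compact R _ (fun=> `[0, 1]%classic)) => i; exact: segment_compact.
  apply: preimage_closed; last exact: closed_eq.
  by move=> v _; apply: (@cvg_sumr _ _ (nbhs v)) => i; exact: cw.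
have S0 : S !=set0 by exists (\row_j p (enum_val j)); rewrite /S/= wE.
have [c] := compact_EVT_max S0 cS (continuous_subspaceT cf).
rewrite inE => Sc cmax; exists (w c) => // q' q'P.
have := cmax (\row_j q' (enum_val j)); rewrite inE /S /=.
by move: (wE q'); rewrite /w => ->; apply.
Qed.

(** * Entropy of mass vectors, optimal codes and the Gibbs bound *)

Definition massH (R : realType) (A : finType) (y : A -> R) : R :=
  \sum_a y a * (ln (\sum_b y b) - ln (y a)).

(** The infinite length is set by hand: as [ln 0 = 0], the formula would give absent letters the
    length [ln N], and Kraft's inequality would fail. *)
Definition shannon (R : realType) (A : finType) (y : A -> R) (a : A) : \bar R :=
  if y a == 0 then +oo%E else (ln (\sum_b y b) - ln (y a))%:E.

Section shannon_code.
Context (R : realType) (A : finType) (y : A -> R).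
Hypotheses (y0 : forall a, 0 <= y a) (N0 : 0 < \sum_b y b).

(** Apply [ln u <= u - 1] to [u = N exp (- l a) / y a] for each letter and sum: the terms [y a] add
    up to [N], and by Kraft the terms [N exp (- l a)] add up to at most [N]. *)
Lemma gibbs (l : A -> \bar R) : kraft R A l ->
  ((massH y)%:E <= \sum_a l a * (y a)%:E)%E.
Proof.
move=> [l0 lk]; pose N := \sum_b y b; have N0' : 0 < N := N0.
have term (a : A) : ((y a * (ln N - ln (y a)) + y a)%:E <=
    l a * (y a)%:E + N%:E * expeR (- l a))%E.
  have [->|ya] := eqVneq (y a) 0.
    rewrite mul0r add0r mule0 add0e mule_ge0// ?expeR_ge0//.
    by rewrite lee_fin ltW.
  have yp : 0 < y a by rewrite lt_neqAle eq_sym ya y0.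
  have := l0 a; case: (l a) => [r| |] //= r0.
    rewrite -!EFinM -EFinD lee_fin.
    have z0 : 0 < N * expR (- r) / y a.
      by rewrite divr_gt0// mulr_gt0// expR_gt0.
    have := @le_ln1Dx R (N * expR (- r) / y a - 1).
    rewrite ltrBrDr addNr => /(_ z0).
    rewrite addrC subrK ln_div ?posrE//; last by rewrite mulr_gt0// expR_gt0.
    rewrite lnM ?posrE ?expR_gt0// expRK => h.
    have /(ler_wpM2l (ltW yp)) := h.
    have -> : y a * (N * expR (- r) / y a - 1) = N * expR (- r) - y a by field.
    nra.
  by rewrite gt0_mulye ?lte_fin// mule0 addye ?ltNye// leey.
have : (\sum_a (y a * (ln N - ln (y a)) + y a)%:E <=
   \sum_a (l a * (y a)%:E + N%:E * expeR (- l a)))%E.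
  by apply: lee_sum => a _; exact: term.
rewrite sumEFin big_split/= big_split/=.
rewrite -ge0_sume_distrr; last by move=> a _; exact: expeR_ge0.
rewrite -/(massH y) -/N => /le_trans; move=> /(_ (\sum_a l a * (y a)%:E + N%:E)%E).
rewrite EFinD leeD2rE// => -> //.
rewrite leeD2l// -[leRHS]mule1 lee_pmul2l ?lte_fin//.
Qed.

Lemma le_mass a : y a <= \sum_b y b.
Proof. by rewrite (bigD1 a)//= lerDl sumr_ge0. Qed.

Lemma shannon_kraft : kraft R A (shannon y).
Proof.
split=> [a|]; rewrite /shannon.
  have [//|ya] := eqVneq (y a) 0.
  have yp : 0 < y a by rewrite lt_neqAle eq_sym ya y0.
  by rewrite lee_fin subr_ge0 ler_ln ?posrE// le_mass.
rewrite (eq_bigr (fun a => (y a / \sum_b y b)%:E)) => [|a _].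
  by rewrite sumEFin -mulr_suml divff// gt_eqF.
have [->|ya] := eqVneq (y a) 0; first by rewrite /= mul0r.
have yp : 0 < y a by rewrite lt_neqAle eq_sym ya y0.
by rewrite /= opprB expRB !lnK ?posrE.
Qed.

(** Infinite lengths meet only zero masses, where [+oo * 0 = 0], so the total length is a real
    number. *)
Lemma shannon_lengthE (z : A -> R) : (forall a, y a = 0 -> z a = 0) ->
  (\sum_a shannon y a * (z a)%:E)%E =
  (\sum_a z a * (ln (\sum_b y b) - ln (y a)))%:E.
Proof.
move=> yz; rewrite -sumEFin; apply: eq_bigr => a _; rewrite /shannon.
have [ya|ya] := eqVneq (y a) 0; first by rewrite yz// mule0 mul0r.
by rewrite -EFinM mulrC.
Qed.

End shannon_code.

(** * First-order conditions at a maximizer of the entropy *)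

Section perturb.
Context (R : realType) (A : finType).
Implicit Types y z : A -> R.

Lemma gibbs_real y z : (forall a, 0 <= y a) -> 0 < \sum_a y a ->
    (forall a, 0 <= z a) -> 0 < \sum_a z a -> (forall a, z a = 0 -> y a = 0) ->
  massH y <= \sum_a y a * (ln (\sum_b z b) - ln (z a)).
Proof.
move=> y0 Ny z0 Nz zy; rewrite -lee_fin -(@shannon_lengthE _ _ z y)//.
by apply: gibbs => //; exact: shannon_kraft.
Qed.

Context (y m : A -> R).
Hypotheses (y0 : forall a, 0 <= y a) (Ny : 0 < \sum_a y a).
Hypotheses (m0 : forall a, 0 <= m a) (Nm : 0 < \sum_a m a).
Let z t a := (1 - t) * y a + t * m a.
Hypothesis zy : forall t, 0 < t < 1 -> massH (z t) <= massH y.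

Let sumz t : \sum_a z t a = (1 - t) * \sum_a y a + t * \sum_a m a.
Proof. by rewrite big_split/= -!mulr_sumr. Qed.

Let z0 t a : 0 < t < 1 -> 0 <= z t a.
Proof. by move=> /andP[t0 t1]; rewrite addr_ge0// mulr_ge0 ?subr_ge0// ltW. Qed.

Let Nz t : 0 < t < 1 -> 0 < \sum_a z t a.
Proof.
by move=> /andP[t0 t1]; rewrite sumz addr_gt0// mulr_gt0// subr_gt0.
Qed.

(** The entropy of [z t] is the length of its own code, which splits into [1 - t] times the length
    on [y] and [t] times that on [m]. The former length is at least [massH y] by Gibbs, while
    [massH (z t) <= massH y]; dividing by [t] leaves the claim. *)
Lemma perturbed_length_le t : 0 < t < 1 ->
  \sum_a m a * (ln (\sum_b z t b) - ln (z t a)) <= massH y.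
Proof.
move=> t01; have /andP[t0 t1] := t01.
set h := fun a => ln (\sum_b z t b) - ln (z t a).
have zE : massH (z t) = (1 - t) * (\sum_a y a * h a) + t * (\sum_a m a * h a).
  rewrite !mulr_sumr -big_split/=; apply: eq_bigr => a _.
  by rewrite {1}/z /h; ring.
have gy : massH y <= \sum_a y a * h a.
  apply: gibbs_real => // [a|| a /eqP]; [exact: z0|exact: Nz|].
  rewrite paddr_eq0 ?mulr_ge0 ?subr_ge0// ?ltW// mulf_eq0 => /andP[+ _].
  by rewrite gt_eqF ?subr_gt0//= => /eqP.
have := zy t01; rewrite zE; have : 0 < 1 - t by rewrite subr_gt0.
nra.
Qed.

(* If y a = 0 < m a, the length of a in the code of z t is at least -ln t + O(1),
   which violates [perturbed_length_le] for small t. *)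
Lemma maximal_support a : y a = 0 -> m a = 0.
Proof.
move=> ya; apply/eqP/negP => /negP ma.
have mp : 0 < m a by rewrite lt_neqAle eq_sym ma m0.
pose N := \sum_b y b.
(* The bound on the term of [a] alone will force [c <= ln t], so [t] is taken with [ln t <= c - 1];
   [t <= 1 / 2] keeps the mass of [z t] above [N / 2]. *)
pose c := ln (N / 2) - ln (m a) - massH y / m a.
pose t := Num.min (1 / 2) (expR (c - 1)).
have t0 : 0 < t by rewrite lt_min expR_gt0 andbT; lra.
have th : t <= 1 / 2 by rewrite ge_min lexx.
have tc : ln t <= c - 1.
  by rewrite -[leRHS]expRK ler_ln ?posrE ?expR_gt0// ge_min lexx orbT.
have t01 : 0 < t < 1 by rewrite t0/=; lra.
have := perturbed_length_le t01; rewrite (bigD1 a)//= => le1.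
have : m a * (ln (\sum_b z t b) - ln (z t a)) <= massH y.
  apply: le_trans le1; rewrite lerDl; apply: sumr_ge0 => b _.
  have [->|mb] := eqVneq (m b) 0; first by rewrite mul0r.
  rewrite mulr_ge0// subr_ge0.
  have zp : 0 < z t b.
    rewrite ltr_wpDl ?mulr_ge0//; first by rewrite subr_ge0; lra.
    by rewrite mulr_gt0// lt_neqAle eq_sym mb m0.
  by rewrite ler_ln ?posrE ?Nz//; apply: le_mass => // b'; exact: z0.
rewrite -ler_pdivlMl// mulrC {2}/z ya mulr0 add0r lnM//.
have : ln (N / 2) <= ln (\sum_b z t b).
  rewrite ler_ln ?posrE ?Nz// ?divr_gt0// sumz -/N.
  have Nt : 0 <= (1 / 2 - t) * N by rewrite mulr_ge0 ?subr_ge0// ltW.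
  have := mulr_gt0 t0 Nm; lra.
rewrite /c in tc; lra.
Qed.

(** Limit of [perturbed_length_le] as [t] tends to 0 from the right. Where [m a] is nonzero,
    [maximal_support] makes [y a] positive, so [ln] is continuous there. *)
Lemma maximal_length_le :
  \sum_a m a * (ln (\sum_b y b) - ln (y a)) <= massH y.
Proof.
have cvg_aff (u v : R) : (1 - t) * u + t * v @[t --> 0^'+] --> u.
  apply: cvg_at_right_filter.
  have {2}-> : u = (1 - 0) * u + 0 * v by ring.
  apply: cvgD; apply: cvgMl; last exact: cvg_id.
  by apply: cvgB; [exact: cvg_cst|exact: cvg_id].
have cvg_len : \sum_a m a * (ln (\sum_b z t b) - ln (z t a)) @[t --> 0^'+] -->
    \sum_a m a * (ln (\sum_b y b) - ln (y a)).
  apply: cvg_sumr => a; have [->|ma] := eqVneq (m a) 0.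
    by under eq_cvg do rewrite mul0r; rewrite mul0r; exact: cvg_cst.
  have ya : 0 < y a.
    rewrite lt_neqAle y0 andbT eq_sym; apply: contra ma => /eqP ya.
    exact/eqP/maximal_support.
  apply: cvgMr; apply: cvgB; apply: continuous_cvg; try exact: continuous_ln.
    by under eq_cvg do rewrite sumz; exact: cvg_aff.
  exact: cvg_aff.
rewrite -(cvg_lim _ cvg_len)//; apply: limr_le; first exact: cvgP cvg_len.
near=> t; apply: perturbed_length_le; apply/andP; split; near: t.
  exact: nbhs_right_gt.
exact: nbhs_right_lt.
Unshelve. all: by end_near.
Qed.

End perturb.

(** * Entropy over the mixtures of a finite family *)

Lemma massHE (R : realType) (A : finType) (y : A -> R) :
  massH y = (\sum_a y a) * ln (\sum_a y a) - \sum_a y a * ln (y a).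
Proof.
rewrite mulr_suml -sumrB; apply: eq_bigr => a _.
by rewrite mulrBr.
Qed.

(** By [massHE] only [x ln x] occurs, which is continuous at 0 too, so masses may tend to 0. *)
Lemma cvg_massH (R : realType) (A : finType) (T : Type) (F : set_system T)
    {FF : Filter F} (f : T -> A -> R) (y : A -> R) :
  (forall a, f t a @[t --> F] --> y a) -> massH (f t) @[t --> F] --> massH y.
Proof.
move=> fy; under eq_cvg do rewrite massHE; rewrite massHE.
apply: cvgB.
  apply: (continuous_cvg _ (@continuous_xlnx R _)); exact: cvg_sumr.
apply: cvg_sumr => a; exact: (continuous_cvg _ (@continuous_xlnx R _)).
Qed.

Section mixtures.
Context (R : realType) (A I : finType) (m : I -> A -> R).
Implicit Types p q : I -> R.
Hypotheses (m0 : forall i a, 0 <= m i a) (Nm : forall i, 0 < \sum_a m i a).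

Definition mix (q : I -> R) (a : A) : R := \sum_i q i * m i a.

Lemma mix_ge0 q a : prob_weights q -> 0 <= mix q a.
Proof. by move=> [q0 _]; apply: sumr_ge0 => i _; rewrite mulr_ge0. Qed.

Lemma mix_mass_gt0 q : prob_weights q -> 0 < \sum_a mix q a.
Proof.
move=> [q0 q1]; rewrite exchange_big/=.
have qN i : 0 <= \sum_a q i * m i a.
  by apply: sumr_ge0 => a _; rewrite mulr_ge0.
rewrite lt_neqAle eq_sym sumr_ge0// andbT; apply/eqP => /psumr_eq0P q_eq0.
have : \sum_i q i = 0.
  apply: big1 => i _; apply/eqP; have /eqP := q_eq0 (fun i _ => qN i) i isT.
  by rewrite -mulr_sumr mulf_eq0 (gt_eqF (Nm i)) orbF.
by rewrite q1 => /eqP; rewrite oner_eq0.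
Qed.

Lemma exists_max_massH p : prob_weights p ->
  exists2 q, prob_weights q &
    forall q', prob_weights q' -> massH (mix q') <= massH (mix q).
Proof.
move=> pP; apply: (@simplex_max _ _ (fun q => massH (mix q)) p) => // v.
apply: (@cvg_massH _ _ _ (nbhs v)) => a; apply: (@cvg_sumr _ _ (nbhs v)) => i.
by apply: cvgMl; exact: coord_continuous.
Qed.

(** Moving the weights towards the point mass at [i] moves the mixture towards [m i], so the
    perturbed vectors are again mixtures. *)
Lemma mix_perturb q i t a :
  mix (fun j => (1 - t) * q j + t * (j == i)%:R) a = (1 - t) * mix q a + t * m i a.
Proof.
rewrite /mix mulr_sumr (bigD1 i)//= [X in _ = X + _](bigD1 i)//= eqxx mulr1.
rewrite (eq_bigr (fun j => (1 - t) * (q j * m j a))); first by ring.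
by move=> j /negPf ->; rewrite mulr0 addr0 mulrA.
Qed.

Lemma prob_weights_perturb (q : I -> R) i t : 0 <= t <= 1 -> prob_weights q ->
  prob_weights (fun j => (1 - t) * q j + t * (j == i)%:R).
Proof.
move=> /andP[t0 t1] [q0 q1]; split=> [j|].
  by rewrite addr_ge0// mulr_ge0// subr_ge0.
rewrite big_split/= -!mulr_sumr q1 (bigD1 i)//= eqxx big1 => [|j /negPf ->//].
by rewrite addr0 !mulr1 subrK.
Qed.

(** Saddle-point inequality: the segment from the maximal mixture to each [m i] consists of
    mixtures, so maximality supplies the hypothesis of the perturbation argument. *)
Lemma max_massH_shannon q : prob_weights q ->
    (forall q', prob_weights q' -> massH (mix q') <= massH (mix q)) ->
  forall i, (\sum_a shannon (mix q) a * (m i a)%:E <= (massH (mix q))%:E)%E.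
Proof.
move=> qP qmax i.
have pert t : 0 < t < 1 ->
    massH (fun a => (1 - t) * mix q a + t * m i a) <= massH (mix q).
  move=> /andP[t0 t1].
  have -> : (fun a => (1 - t) * mix q a + t * m i a) =
      mix (fun j => (1 - t) * q j + t * (j == i)%:R).
    by apply/funext => a; rewrite mix_perturb.
  by apply/qmax/prob_weights_perturb => //; rewrite !ltW.
have y0 a : 0 <= mix q a := mix_ge0 a qP.
have Ny := mix_mass_gt0 qP.
rewrite shannon_lengthE; first by rewrite lee_fin; exact: maximal_length_le.
by move=> a; exact: maximal_support.
Qed.

End mixtures.

(** * From set functions to mass vectors *)

Section measures.
Context (R : realType) (A : finType).
Implicit Types (nu : set A -> \bar R) (y : A -> R).

(** These are the only values of [nu] that [entropy] and [code_length] read, so mixtures can be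
    treated as bare set functions. *)
Definition has_mass nu y := [/\ forall a, 0 <= y a, 0 < \sum_a y a,
  forall a, nu [set a] = (y a)%:E & nu setT = (\sum_a y a)%:E].

Lemma entropy_massH nu y : has_mass nu y -> entropy nu = massH y.
Proof.
move=> [y0 Ny nu1 nuT]; rewrite /entropy /prob_entropy /normalized nuT/=.
rewrite mulrN -mulrN -sumrN mulr_sumr; apply: eq_bigr => a _; rewrite nu1/=.
have [->|ya] := eqVneq (y a) 0; first by rewrite !mul0r oppr0 mulr0.
have yp : 0 < y a by rewrite lt_neqAle eq_sym ya y0.
by rewrite ln_div ?posrE//; field; rewrite gt_eqF.
Qed.

Lemma code_length_mass l nu y :
  has_mass nu y -> code_length l nu = (\sum_a l a * (y a)%:E)%E.
Proof. by move=> [_ _ nu1 _]; apply: eq_bigr => a _; rewrite nu1. Qed.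

Section mixture.
Context (I : finType) (q : I -> R) (nu : I -> set A -> \bar R) (m : I -> A -> R).
Hypotheses (qP : prob_weights q) (num : forall i, has_mass (nu i) (m i)).

Lemma mixture_mass : has_mass (mixture q nu) (mix m q).
Proof.
have m0 i a : 0 <= m i a by have [] := num i.
have Nm i : 0 < \sum_a m i a by have [] := num i.
split=> [a||a|]; [exact: mix_ge0|exact: mix_mass_gt0| |].
  rewrite -sumEFin; apply: eq_bigr => i _.
  by have [_ _ -> _] := num i; rewrite EFinM.
rewrite exchange_big/= -sumEFin; apply: eq_bigr => i _.
by have [_ _ _ ->] := num i; rewrite -mulr_sumr EFinM.
Qed.

(** Lengths may be infinite; nonnegativity of all terms justifies distributing and exchanging the
    sums in [\bar R]. *)
Lemma code_length_mixture l : (forall a, 0 <= l a)%E ->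
  code_length l (mixture q nu) = (\sum_i (q i)%:E * code_length l (nu i))%E.
Proof.
move=> l0; rewrite (code_length_mass _ mixture_mass).
under [RHS]eq_bigr => i _.
  rewrite (code_length_mass _ (num i)) ge0_sume_distrr => [|a _]; last first.
    by rewrite mule_ge0// lee_fin; have [] := num i.
  over.
rewrite exchange_big/=; apply: eq_bigr => a _.
rewrite -sumEFin ge0_sume_distrr => [|i _]; last first.
  by rewrite lee_fin mulr_ge0//; [case: qP|have [] := num i].
by apply: eq_bigr => i _; rewrite EFinM muleCA.
Qed.

End mixture.
End measures.

Lemma mixture_hull (R : realType) (A : Type) (I : finType) (q : I -> R)
    (nu : I -> set A -> \bar R) : prob_weights q ->
  convex_hull [set nu i | i in [set: I]] (mixture q nu).
Proof.
move=> [q0 q1]; exists #|I|, (q \o enum_val), (nu \o enum_val).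
have reE (V : nmodType) (F : I -> V) : \sum_i F i = \sum_(j < #|I|) F (enum_val j).
  by rewrite (reindex _ (onW_bij _ (enum_val_bij I))).
split; first by split=> [i|/=]; [exact: q0|rewrite -reE].
  by move=> j; exists (enum_val j).
by apply/funext => X; rewrite /mixture reE.
Qed.

Lemma ge0_sum_le_bigmax (R : realType) (I : finType) (q : I -> R)
    (x : I -> \bar R) : prob_weights q -> (forall i, 0 <= x i)%E ->
  (\sum_i (q i)%:E * x i <= \big[maxe/-oo]_i x i)%E.
Proof.
move=> [q0 q1] x0; set M := (\big[maxe/-oo]_i x i)%E.
apply: (@le_trans _ _ (\sum_i (q i)%:E * M)%E).
  apply: lee_sum => i _; apply: lee_wpmul2l; first by rewrite lee_fin.
  exact: le_bigmax.
rewrite -ge0_sume_distrl => [|i _]; last by rewrite lee_fin.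
by rewrite sumEFin q1 mul1e.
Qed.

Lemma finite_measure_mass (R : realType) (d : measure_display)
    (A : finMeasurableType d) (A_discrete : forall X : set A, measurable X)
    (nu : {finite_measure set A -> \bar R}) : nu setT != 0%E ->
  has_mass nu (fun a => fine (nu [set a])).
Proof.
move=> nu0.
have fin a : (fine (nu [set a]))%:E = nu [set a].
  by rewrite fineK// fin_num_measure.
have nuT : nu setT = (\sum_a fine (nu [set a]))%:E.
  (* The alphabet is a finite disjoint union of singletons, so additivity gives the total mass. *)
  have -> : [set: A] = \bigcup_(a in [set` enum A]) [set a].
    by apply/seteqP; split=> // a _; exists a => //=; rewrite mem_enum.
  rewrite measure_fin_bigcup//; last by move=> a b _ _ [x [/= -> ->]].
  rewrite -fsbig_seq ?enum_uniq// big_enum/= -sumEFin.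
  by apply: eq_bigr => a _; rewrite fin.
split=> // [a|].
  by rewrite fine_ge0.
by rewrite -lte_fin -nuT lt_neqAle eq_sym nu0 measure_ge0.
Qed.

(** * The two minimal code lengths and their equality *)

Local Open Scope ereal_scope.

Theorem theorem9 (R : realType) (d : measure_display) (A : finMeasurableType d)
    (A_discrete : forall X : set A, measurable X)
    (Omega : finType) (Omega_nonempty : (0 < #|Omega|)%N)
    (mu : Omega -> {finite_measure set A -> \bar R})
    (mu_empirical : forall w, empirical (mu w))
    (mu_nonzero : forall w, mu w setT != 0)
    (p : Omega -> R) (p_prob : prob_weights p) :
  exists minmax minavg : \bar R,
    [/\ is_min [set \big[maxe/-oo]_(w : Omega) code_length l (mu w)
               | l in kraft R A] minmax,
        is_min [set \sum_(w : Omega) (p w)%:E * code_length l (mu w)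
               | l in kraft R A] minavg &
        minmax = minavg <->
        exists mustar : set A -> \bar R,
          max_entropy_measure
            (convex_hull [set (mu w : set A -> \bar R) | w in [set: Omega]])
            mustar /\
          mixture p (fun w => mu w : set A -> \bar R) = mustar].
Proof.
pose nu w : set A -> \bar R := mu w.
pose m w (a : A) := fine (mu w [set a]).
have num w : has_mass (nu w) (m w) by exact: finite_measure_mass.
have m0 w a : (0 <= m w a)%R by have [] := num w.
have Nm w : (0 < \sum_a m w a)%R by have [] := num w.
have [q qP qmax] := exists_max_massH m p_prob.
have gibbs_mix r l : prob_weights r -> kraft R A l ->
    (massH (mix m r))%:E <= \sum_w (r w)%:E * code_length l (mu w).
  move=> rP lK; rewrite -(code_length_mixture rP num); last by case: lK.
  rewrite (code_length_mass _ (mixture_mass rP num)); apply: gibbs => //.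
    by move=> a; exact: mix_ge0.
  exact: mix_mass_gt0.
have shannonK r : prob_weights r -> kraft R A (shannon (mix m r)).
  move=> rP; apply: shannon_kraft; last exact: mix_mass_gt0.
  by move=> a; exact: mix_ge0.
have length_le w : code_length (shannon (mix m q)) (mu w) <= (massH (mix m q))%:E.
  by rewrite (code_length_mass _ (num w)); exact: max_massH_shannon.
have lower l : kraft R A l ->
    (massH (mix m q))%:E <= \big[maxe/-oo]_w code_length l (mu w).
  move=> lK; apply: le_trans (gibbs_mix _ _ qP lK) _.
  apply: ge0_sum_le_bigmax => // w; apply: sume_ge0 => a _.
  by rewrite mule_ge0//; case: lK.
have entropy_mix r : prob_weights r -> entropy (mixture r nu) = massH (mix m r).
  by move=> rP; exact: entropy_massH (mixture_mass rP num).
exists (massH (mix m q))%:E, (massH (mix m p))%:E; split.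
- split=> [|_ [l lK <-]]; last exact: lower.
  (* The optimal code of the maximal mixture attains the minimax. *)
  exists (shannon (mix m q)); first exact: shannonK.
  apply/eqP; rewrite eq_le lower ?andbT; last exact: shannonK.
  by apply: bigmax_le => [|w _]; [exact: leNye|exact: length_le].
- split=> [|_ [l lK <-]]; last exact: gibbs_mix.
  exists (shannon (mix m p)); first exact: shannonK.
  rewrite -(code_length_mixture p_prob num); last by case: (shannonK _ p_prob).
  rewrite (code_length_mass _ (mixture_mass p_prob num)).
  by rewrite shannon_lengthE.
- split=> [/eqP|[mustar [[_ +] mixE]]]; last first.
    rewrite -mixE => pmax.
    congr EFin; apply/eqP; rewrite eq_le qmax// andbT.
    rewrite -[leLHS](entropy_mix _ qP) -[leRHS](entropy_mix _ p_prob).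
    by apply: pmax; exact: mixture_hull.
  rewrite eqe => /eqP Vqp.
  exists (mixture p nu); split=> //; split; first exact: mixture_hull.
  move=> _ [n [r [k [rP kmu ->]]]].
  (* A point of the hull has its own index set ['I_n], possibly repeating measures; [v] maps its
     indices back to [Omega]. *)
  have /choice[v kE] : forall i, exists w, nu w = k i.
    by move=> i; have [w _ wE] := kmu i; exists w.
  have {kmu kE} -> : k = nu \o v by apply/funext => i; rewrite /= kE.
  have numv i : has_mass ((nu \o v) i) ((m \o v) i) by exact: num.
  rewrite (entropy_massH (mixture_mass rP numv)) entropy_mix// -Vqp -lee_fin.
  (* Maximality of [q] concerns weights on [Omega] only. For weights [r] on ['I_n], the code of
     [mix m q] is used instead: its length is at least the entropy by Gibbs, and at most
     [massH (mix m q)] on each measure. *)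
  apply: (@le_trans _ _ (code_length (shannon (mix m q)) (mixture r (nu \o v)))).
    rewrite (code_length_mass _ (mixture_mass rP numv)).
    have [r0 rN _ _] := mixture_mass rP numv.
    by apply: gibbs => //; exact: shannonK.
  rewrite (code_length_mixture rP numv); last by case: (shannonK _ qP).
  have [r0 r1] := rP.
  apply: (@le_trans _ _ (\sum_i (r i)%:E * (massH (mix m q))%:E)).
    by apply: lee_sum => i _; apply: lee_wpmul2l; [rewrite lee_fin|exact: length_le].
  rewrite -ge0_sume_distrl => [|i _]; last by rewrite lee_fin.
  by rewrite sumEFin r1 mul1e.
Qed.
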